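(* Let $(\mathcal{A},\tau)$ be a tracial non-commutative probability space, let $P,Q\in\mathcal{A}$ be two orthogonal projections, and let $C:=i(PQ-QP)$ where $i=\sqrt{-1}$. Then for any integer $j\ge 1$, $$\tau(C^{2j})=2\,\tau\big[(PQP(P-PQP))^j\big].$$
   Context: A tracial non-commutative probability space $(\mathcal{A},\tau)$ is a unital complex $*$-algebra $\mathcal{A}$ with unit ${\bf 1}$ together with a state $\tau$ ($\tau({\bf 1})=1$) satisfying $\tau(xy)=\tau(yx)$. An orthogonal projection is an element $P$ with $P=P^\star=P^2$. No freeness or general position assumption is made on $P,Q$. *)

(* Defs.v *)
(* The complex numbers are rendered as [R[i]] for an arbitrary [R : realType]. *)
From HB Require Import structures.
From mathcomp Require Import all_boot all_order all_algebra.
From mathcomp Require Import reals complex.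

Set Implicit Arguments.
Unset Strict Implicit.
Unset Printing Implicit Defensive.
Import Order.TTheory GRing.Theory Num.Theory.
Local Open Scope ring_scope.

HB.mixin Record Algebra_isStarAlgebra (R : realType) A
    of GRing.Algebra R[i] A := {
  star : A -> A;
  starK : forall x, star (star x) = x;
  starD : forall x y, star (x + y) = star x + star y;
  starZ : forall (a : R[i]) x, star (a *: x) = (a^*)%C *: star x;
  starM : forall x y, star (x * y) = star y * star x
}.

#[short(type="starAlgType")]
HB.structure Definition StarAlgebra (R : realType) :=
  {A of Algebra_isStarAlgebra R A & GRing.Algebra R[i] A}.

(* On [R[i]], [0 <= z] says that [z] is real and nonnegative. *)
Definition is_state (R : realType) (A : starAlgType R) (tau : {scalar A}) :=
  tau 1 = 1 /\ forall x : A, 0 <= tau (star x * x).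

Definition is_tracial (R : realType) (A : starAlgType R) (tau : {scalar A}) :=
  forall x y : A, tau (x * y) = tau (y * x).

Record tracialNCProbSpace (R : realType) := TracialNCProbSpace {
  ncAlg :> starAlgType R;
  ncTau : {scalar ncAlg};
  ncTau_state : is_state ncTau;
  ncTau_tracial : is_tracial ncTau
}.

Definition is_orthogonal_projection (R : realType) (A : starAlgType R)
    (P : A) :=
  P = star P /\ P = P ^+ 2.

(* Main.v *)
Require Import Defs.
From HB Require Import structures.
From mathcomp Require Import all_boot all_order all_algebra.
From mathcomp Require Import reals complex.

Set Implicit Arguments.
Unset Strict Implicit.
Unset Printing Implicit Defensive.
Import Order.TTheory GRing.Theory Num.Theory.
Local Open Scope ring_scope.

(** The point is that the commutator of a projection [P] with anything is
    off-diagonal for the decomposition [1 = P + (1 - P)]: with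
    [C = i (P Q - Q P)], the relation [P C = C (1 - P)] holds
    ([idem_mul_commutator]).  Hence [C] swaps the two corners, so [C ^+ 2]
    commutes with [P], and cyclicity of the trace gives
      [tau (P C ^+ (2 j)) = tau (C (1 - P) C ^+ (2 j - 1))
                          = tau ((1 - P) C ^+ (2 j))],
    that is, the two corners of [C ^+ (2 j)] have the same trace and
    [tau (C ^+ (2 j)) = 2 tau (P C ^+ (2 j))].  As [P] is an idempotent
    commuting with [C ^+ 2], the [P]-corner is [(P C ^+ 2) ^+ j]
    ([trace_exp_swap]), and [P C ^+ 2] is [P Q P (P - P Q P)]
    ([idem_mul_sqr_commutator]). *)

Section Swap.

Variables (S : pzRingType) (P C : S).
Hypotheses (idemP : P * P = P) (swapPC : P * C = C * (1 - P)).

Lemma swap_compl : (1 - P) * C = C * P.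
Proof. by rewrite mulrBl mul1r swapPC mulrBr mulr1 opprB addrC subrK. Qed.

Lemma swap_comm_sqr : GRing.comm P (C ^+ 2).
Proof. by rewrite /GRing.comm expr2 mulrA swapPC -!mulrA swap_compl. Qed.

Lemma idem_exp n : P ^+ n.+1 = P.
Proof. by elim: n => // n IHn; rewrite exprS IHn. Qed.

(** The trace of an even power of [C] splits into two corners of equal trace,
    because moving one factor [C] cyclically around exchanges [P] and [1 - P].
    The exponent must be positive for such a factor to exist. *)
Lemma trace_exp_swap (V : zmodType) (f : {additive S -> V}) n :
    (forall x y, f (x * y) = f (y * x)) ->
  f (C ^+ (2 * n.+1)) = f ((P * C ^+ 2) ^+ n.+1) *+ 2.
Proof.
move=> f_tr.
have corners : f (P * C ^+ (2 * n.+1)) = f ((1 - P) * C ^+ (2 * n.+1)).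
  rewrite mulnS addSn {1}exprS mulrA swapPC -mulrA f_tr -mulrA.
  by rewrite -exprSr.
rewrite exprMn_comm; last exact: swap_comm_sqr.
rewrite idem_exp -exprM mulr2n {2}corners -raddfD -mulrDl.
by rewrite addrC subrK mul1r.
Qed.

End Swap.

Section Commutator.

Variables (S : pzRingType) (P Q : S).
Hypothesis idemP : P * P = P.

(** Both sides are the off-diagonal corner [P Q (1 - P)]. *)
Lemma idem_mul_commutator :
  P * (P * Q - Q * P) = (P * Q - Q * P) * (1 - P).
Proof.
rewrite mulrBr mulrBr mulr1 mulrBl !mulrA idemP -(mulrA Q P P) idemP.
by rewrite opprB addrA subrK.
Qed.

Lemma idem_mul_sqr_commutator : Q * Q = Q ->
  P * (P * Q - Q * P) ^+ 2 = - (P * Q * P * (P - P * Q * P)).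
Proof.
move=> idemQ.
have PP x : x * P * P = x * P by rewrite -mulrA idemP.
have QQ x : x * Q * Q = x * Q by rewrite -mulrA idemQ.
rewrite expr2 !(mulrBl, mulrBr) !mulrA idemP !(PP, QQ).
by rewrite !opprB addrC addrA subrK.
Qed.

End Commutator.

Theorem theorem2 (R : realType) (A : tracialNCProbSpace R) (P Q : A)
    (hP : is_orthogonal_projection P) (hQ : is_orthogonal_projection Q)
    (j : nat) (hj : (1 <= j)%N) :
  let tau := @ncTau R A in
  let C : A := ('i%C : R[i]) *: (P * Q - Q * P) in
  tau (C ^+ (2 * j)) = 2 * tau ((P * Q * P * (P - P * Q * P)) ^+ j).
Proof.
move: hP hQ => [_ /esym idemP] [_ /esym idemQ] tau C.
rewrite expr2 in idemP; rewrite expr2 in idemQ.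
have swapPC : P * C = C * (1 - P).
  by rewrite /C -scalerAr -scalerAl idem_mul_commutator.
have cornerC2 : P * C ^+ 2 = P * Q * P * (P - P * Q * P).
  rewrite /C exprZn sqr_i scaleN1r mulrN idem_mul_sqr_commutator //.
  exact: opprK.
case: j hj => // n _.
rewrite (trace_exp_swap idemP swapPC) ?cornerC2 ?mulr_natl //.
exact: ncTau_tracial.
Qed.
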